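(* Let $X=[0,\omega_1)\cup D$, where $D=\{d_\alpha : \alpha<\omega_1\}$ is a set of cardinality $\omega_1$ (disjoint from $[0,\omega_1)$, with the $d_\alpha$ distinct), topologized as follows: $[0,\omega_1)$ carries its usual order topology and is an open subspace of $X$, and a basic neighbourhood of a point $d_\alpha\in D$ has the form $O_\beta(d_\alpha)=\{d_\alpha\}\cup(\beta,\omega_1)$, where $\beta<\omega_1$. Then $X$ is star-K-Menger.
   Context: For a subset $A$ of a space $X$ and a collection $\mathcal{P}$ of subsets of $X$, $St(A,\mathcal{P})=\bigcup\{B\in\mathcal{P} : A\cap B\neq\emptyset\}$. A space $X$ is star-K-Menger if for each sequence $(\mathcal{U}_n)_{n\in\mathbb{N}}$ of open covers of $X$ there exists a sequence $(K_n)_{n\in\mathbb{N}}$ of compact subsets of $X$ such that $\{St(K_n,\mathcal{U}_n) : n\in\mathbb{N}\}$ is an open cover of $X$. Compactness does not include the Hausdorff property. *)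

(* Defs.v *)
From HB Require Import structures.
From mathcomp Require Import all_boot all_order interval.
From mathcomp Require Import all_classical topology wochoice.

Set Implicit Arguments.
Unset Strict Implicit.
Unset Printing Implicit Defensive.

Import Order.TTheory.
Local Open Scope classical_set_scope.

Definition open_cover (X : topologicalType) (P : set (set X)) : Prop :=
  P `<=` open /\ \bigcup_(B in P) B = setT.

Definition star (X : Type) (A : set X) (P : set (set X)) : set X :=
  \bigcup_(B in [set B | P B /\ A `&` B !=set0]) B.

(* [compact] is the filter-based notion and does not include Hausdorff. *)
Definition star_K_Menger (X : topologicalType) : Prop :=
  forall U : nat -> set (set X), (forall n, open_cover (U n)) ->
  exists K : nat -> set X,
    (forall n, compact (K n)) /\ open_cover (range (fun n => star (K n) (U n))).

(* W is well-ordered, uncountable, and all its proper initial segments are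
   countable: this says exactly that W is order isomorphic to [0, omega_1). *)
Definition is_omega1 (disp : Order.disp_t) (W : orderType disp) : Prop :=
  [/\ well_order (<=%O : rel W),
      ~ countable [set: W]
    & forall a : W, countable [set b | (b < a)%O]].

(* The set [0, omega_1) \cup D with D = {d_a : a < omega_1}. *)
Variant omega1D (W : Type) : Type := ordinal_pt of W | d_pt of W.
Arguments d_pt {W}.
Arguments ordinal_pt {W}.

HB.instance Definition _ (W : Type) := gen_eqMixin (omega1D W).
HB.instance Definition _ (W : Type) := gen_choiceMixin (omega1D W).

Section omega1D_topology.
Context (disp : Order.disp_t) (W : orderTopologicalType disp).

Definition Obeta (beta a : W) : set (omega1D W) :=
  [set d_pt a] `|` ordinal_pt @` [set c | (beta < c)%O].

Definition omega1D_nbhs (x : omega1D W) : set_system (omega1D W) :=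
  match x with
  | ordinal_pt a => [set A | nbhs a (ordinal_pt @^-1` A)]
  | d_pt a => [set A | exists beta, Obeta beta a `<=` A]
  end.

HB.instance Definition _ := hasNbhs.Build (omega1D W) omega1D_nbhs.

Let omega1D_nbhs_filter (x : omega1D W) : ProperFilter (nbhs x).
Proof.
case: x => a; apply: Build_ProperFilter_ex.
- by move=> A Aa; exists (ordinal_pt a); exact: (@nbhs_singleton _ a _ Aa).
- by move=> A [b bA]; exists (d_pt a); apply: bA; left.
- split; first by exists a.
  + move=> A B [b bA] [c cB]; exists (Order.max b c) => x [->|[e /= + <-]].
      by split; [apply: bA; left|apply: cB; left].
    rewrite gt_max => /andP[be ce].
    by split; [apply: bA|apply: cB]; right; exists e.
  + by move=> A B AB [b bA]; exists b; exact: subset_trans AB.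
Qed.

Let omega1D_nbhs_singleton (x : omega1D W) (A : set (omega1D W)) :
  nbhs x A -> A x.
Proof.
case: x => a; last by case=> b; apply; left.
by move=> Aa; exact: (@nbhs_singleton _ a _ Aa).
Qed.

Let omega1D_nbhs_nbhs (x : omega1D W) (A : set (omega1D W)) :
  nbhs x A -> nbhs x (nbhs^~ A).
Proof.
case: x => a; first by move=> Aa; exact: (@nbhs_interior _ a _ Aa).
case=> b bA; exists b => x [->|[c /= bc <-]]; first by exists b.
suff bnbhs : nbhs c [set e | (b < e)%O].
  by apply: filterS bnbhs => e be; apply: bA; right; exists e.
have -> : [set e | (b < e)%O] = [set` `]b, +oo[%O].
  by apply/seteqP; split => e /=; rewrite in_itv/= andbT.
by apply: open_nbhs_nbhs; split; [exact: rray_open|rewrite /= in_itv/= bc].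
Qed.

HB.instance Definition _ := Nbhs_isNbhsTopological.Build (omega1D W)
  omega1D_nbhs_filter omega1D_nbhs_singleton omega1D_nbhs_nbhs.

End omega1D_topology.

(* [is_omega1] is inhabited: an instance is carved out of a well-ordering of
   the power set of nat. *)
Module Omega1Model.

Definition wo_set_nat : rel (set nat) :=
  sval (well_ordering_principle (set nat)).

Lemma wo_set_natP : well_order wo_set_nat.
Proof. exact: svalP (well_ordering_principle (set nat)). Qed.

Definition omega1 : Type :=
  {x : set nat | `[< countable [set y | wo_set_nat y x /\ y != x] >]}.

HB.instance Definition _ := Choice.on omega1.

Definition le (x y : omega1) := wo_set_nat (val x) (val y).
Lemma wo_le : well_order le.
Proof.
apply: antisymmetric_well_order => [x y xy|A [x Ax]].
  apply: val_inj; apply: (wo_chain_antisymmetric (C := predT)) => //.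
    exact: (withinW (A := predT) wo_set_natP).
  exact: xy.
have [|z [[/asboolP[u Au uz] zA] _]] := @wo_set_natP (fun y => `[< exists2 u, u \in A & val u = y >]).
  by exists (val x); apply/asboolP; exists x.
exists u; split=> // y Ay; rewrite /le uz; apply: zA.
by apply/asboolP; exists y.
Qed.

Lemma le_refl : reflexive le.
Proof. by move=> x; apply: (wo_chain_reflexive (C := predT) (withinW (A:=predT) wo_le)). Qed.

Lemma le_anti : antisymmetric le.
Proof. by move=> x y; apply: (wo_chain_antisymmetric (C := predT) (withinW (A:=predT) wo_le)). Qed.

Lemma le_total : total le.
Proof. by move=> x y; apply: (wo_chainW (C := predT) (withinW (A:=predT) wo_le)). Qed.

Lemma le_trans : transitive le.
Proof.
move=> y x z xy yz.
have [|m [[+ mP] _]] := @wo_le (mem [:: x; y; z]).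
  by exists x; rewrite !inE eqxx.
rewrite !inE => /or3P[] /eqP E; rewrite E in mP.
- by apply: mP; rewrite !inE eqxx !orbT.
- have -> // : x = y by apply/le_anti; rewrite xy mP// !inE eqxx.
- have <- // : y = z by apply/le_anti; rewrite yz mP// !inE eqxx !orbT.
Qed.

HB.instance Definition _ := Order.Le_isPOrder.Build (Order.Disp tt tt) omega1 le_refl le_anti le_trans.
HB.instance Definition _ := Order.POrder_isTotal.Build (Order.Disp tt tt) omega1 le_total.

Lemma cantor : ~ countable [set: set nat].
Proof.
move=> /countable_injP[f fI].
pose D : set nat := [set n | exists2 A, f A = n & ~ A n].
have [Df|nDf] := pselect (D (f D)); last by apply: (nDf); exists D.
by case: (Df) => A /fI; rewrite !inE => /(_ I I) ->.
Qed.

Lemma is_omega1_omega1 : is_omega1 (order_topology omega1).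
Proof.
split; first exact: wo_le.
- move=> cW; apply: cantor.
  pose G := [set x : set nat | countable [set y | wo_set_nat y x /\ y != x]].
  have cG : countable G.
    apply: sub_countable cW; apply: card_le_trans (card_image_le val _).
    apply: subset_card_le => x Gx.
    by exists (exist _ x (asboolT Gx) : omega1).
  suff -> : [set: set nat] = G by [].
  apply/seteqP; split=> // x _; apply: contrapT => nGx.
  have [|z [[/asboolP nGz zm] _]] := @wo_set_natP (fun y => `[< ~ G y >]).
    by exists x; apply/asboolP.
  apply: nGz; apply: sub_countable cG; apply: subset_card_le => y [/= yz ne].
  apply: contrapT => nGy; move/negP: ne; apply; apply/eqP.
  apply: (wo_chain_antisymmetric (C := predT) (withinW (A:=predT) wo_set_natP)) => //.
  by rewrite yz zm //; apply/asboolP.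
- move=> a; have /asboolP := svalP a; apply: sub_countable.
  have /card_eqPle[_] := inj_card_eq (A := [set b : omega1 | (b < a)%O]) (f := val) (in2W val_inj).
  move/card_le_trans; apply; apply: subset_card_le => _ [b /= ba <-].
  split; first exact: (ltW ba).
  by apply/eqP => /val_inj e; rewrite e ltxx in ba.
Qed.

End Omega1Model.

Lemma is_omega1_inhabited :
  exists (disp : Order.disp_t) (W : orderTopologicalType disp), is_omega1 W.
Proof. by do 2 eexists; exact: Omega1Model.is_omega1_omega1. Qed.

(* Main.v *)
Require Import Defs.
From mathcomp Require Import all_boot all_order interval.
From mathcomp Require Import all_classical topology.

(** Every neighbourhood of a point of [D] contains a final segment of
    [0, omega_1), so adding a single point [d] of [D] to [0, omega_1) yields a
    compact set [K]. Every open set containing a point of [D] meets [0, omega_1),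
    hence [K] meets every nonempty open set of X and the star of [K] with
    respect to any open cover is already all of X. *)

Import Order.TTheory.
Local Open Scope classical_set_scope.

Lemma is_omega1_min (disp : Order.disp_t) (W : orderType disp) (A : set W) :
  is_omega1 W -> A !=set0 -> exists2 m, A m & forall x, A x -> (m <= x)%O.
Proof.
move=> [wo _ _] [a Aa]; have [|m [[/asboolP Am mA] _]] := wo (fun x => `[< A x >]).
  by exists a; apply/asboolP.
by exists m => // x Ax; apply: mA; apply/asboolP.
Qed.

(** A maximum [b] would make [W] the union of [[set b]] and a countable initial segment, hence
    countable. *)
Lemma is_omega1_no_max (disp : Order.disp_t) (W : orderType disp) (b : W) :
  is_omega1 W -> exists c, (b < c)%O.
Proof.
move=> [_ uncW cW]; apply: contrapT => bmax; apply: uncW.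
have -> : [set: W] = [set b] `|` [set x | (x < b)%O].
  apply/seteqP; split=> // x _; have [xb|bx|->] := ltgtP x b; [by right| |by left].
  by exfalso; apply: bmax; exists x.
rewrite -bigcup2E; apply: bigcup_countable => // -[|[|i]] _ /=.
- exact: countable1.
- exact: cW.
- exact: countable0.
Qed.

Section omega1D.
Context (disp : Order.disp_t) (W : orderTopologicalType disp) (hW : is_omega1 W).

(* A proper filter F on the set clusters at the least [m] such that every member
   of F meets [0, m], and at [d_pt a] if there is no such [m]. *)
Lemma compact_ordinals_d_pt (a : W) :
  compact (range (@ordinal_pt W) `|` [set d_pt a]).
Proof.
move=> F PF FK.
pose T : set W :=
  [set c | forall A, F A -> exists2 x, A (ordinal_pt x) & (x <= c)%O].
have notT c : ~ T c -> exists2 A, F A & forall x, A (ordinal_pt x) -> (c < x)%O.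
  move=> Tc; apply: contrapT => nA; apply: Tc => A FA.
  apply: contrapT => nx; apply: nA; exists A => // x Ax.
  by rewrite ltNge; apply/negP => xc; apply: nx; exists x.
have [T0|/set0P T0] := eqVneq T set0; last first.
  have [m Tm mT] := is_omega1_min _ _ _ hW T0.
  exists (ordinal_pt m); split; first by left; exists m.
  move=> A V FA mV; have : nbhs m (ordinal_pt @^-1` V) by [].
  rewrite itv_nbhsE => -[[l r] [io mi] iV].
  (* Points up to [m] respect the right end, so only the left end matters. If it is some [l], then
     [l < m], and minimality of [m] gives a member of [F] missing [0, l]; otherwise [setT]
     serves. *)
  have [B FB BV] : exists2 B, F B &
      forall x, B (ordinal_pt x) -> (x <= m)%O -> x \in Interval l r.
    case: l io mi {iV} => [b l|b] io mi; last first.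
      exists setT; first exact: filterT.
      move=> x _ xm; move: mi; rewrite !itv_boundlr => /andP[lm mr].
      by rewrite (le_trans _ mr) ?bnd_simp// andbT; case: b io lm.
    have lm : (l < m)%O.
      by move: mi; rewrite (itv_open_ends_lside io) itv_boundlr => /andP[].
    have [|B FB Bl] := notT l; first by move=> /mT; rewrite leNgt lm.
    exists B => // x Bx xm; move: mi; rewrite !itv_boundlr => /andP[_ mr].
    rewrite (le_trans _ mr) ?bnd_simp// andbT.
    by rewrite (itv_open_ends_lside io) bnd_simp Bl.
  have [x [Ax Bx] xm] := Tm _ (filterI FA FB).
  by exists (ordinal_pt x); split=> //; apply: iV; exact: BV.
(* As [T] is empty, each [0, b] is missed by some member of [F], whose trace on the set lies in
   [Obeta b a]. *)
exists (d_pt a); split; first by right.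
move=> A V FA [b bV]; have [|B FB Bb] := notT b; first by rewrite T0.
have [x [[Ax Bx] Kx]] := filter_ex (filterI (filterI FA FB) FK).
exists x; split=> //; apply: bV; case: Kx Bx => [[y _ <-] By|-> _]; last by left.
by right; exists y => //; exact: Bb.
Qed.

Lemma open_meets_ordinals (B : set (omega1D W)) :
  open B -> B !=set0 -> range (@ordinal_pt W) `&` B !=set0.
Proof.
rewrite openE => oB [[w|w] Bx]; first by exists (ordinal_pt w).
(* Without a maximum, the final segment beyond [b] inside [B] is nonempty. *)
have [b bB] := oB _ Bx; have [c bc] := is_omega1_no_max _ _ b hW.
by exists (ordinal_pt c); split=> //; apply: bB; right; exists c.
Qed.

End omega1D.

Theorem mainTheorem1 (disp : Order.disp_t) (W : orderTopologicalType disp)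
  (hW : is_omega1 W) : star_K_Menger (omega1D W).
Proof.
move=> U Ucover.
have [a _] : [set: W] !=set0.
  apply/set0P/eqP => W0; have [_ uncW _] := hW.
  by apply: uncW; rewrite W0; exact: countable0.
pose K := range (@ordinal_pt W) `|` [set d_pt a].
have starK n : star K (U n) = setT.
  have [oU UT] := Ucover n; apply/seteqP; split=> // x _.
  have [B UB Bx] : (\bigcup_(B in U n) B) x by rewrite UT.
  exists B => //; split=> //.
  have [|y [Ry By]] := open_meets_ordinals _ _ hW B (oU _ UB); first by exists x.
  by exists y; split=> //; left.
(* A constant sequence suffices: each single star, say at index 0, covers the space. *)
exists (fun=> K); split; first by move=> _; exact: compact_ordinals_d_pt.
split; first by move=> _ [n _ <-]; rewrite starK; exact: openT.
apply/seteqP; split=> // x _; exists (star K (U 0)); first by exists 0.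
by rewrite starK.
Qed.
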